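(* Both $\equiv_m$ and $\equiv_1$ on $2^\omega$ are $\Sigma^0_2(\mathrm{TOT})$, where $\mathrm{TOT}=\{e:\varphi_e\text{ is total}\}$. Hence both are learnable by a $\mathrm{TOT}$-computable learner.
   Context: For $x,y\in 2^\omega$, $x\equiv_m y$ iff each of $x,y$ is many-one reducible to the other via a total computable function (i.e., there is total computable $\varphi_e$ with $x(n)=1\iff y(\varphi_e(n))=1$ for all $n$, and symmetrically); $\equiv_1$ is the same with one-to-one reducing functions. An equivalence relation $E$ on $2^\omega$ is learnable by a $b$-computable learner if there are continuous $l_n:(2^\omega)^\omega\times 2^\omega\to\omega$ with: for all $x$, $\vec x=(x_i)$, if $x\mathrel{E}x_i$ for some $i$ then $L=\lim_n l_n(\vec x,x)$ exists and $x\mathrel{E}x_L$; and there is a $b$-recursive $f$ such that each $l_n$ is computed by the Turing functional with index $f(n)$ relative to oracle $b$. *)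

(* Defs.v *)
From Stdlib Require Cantor.
From mathcomp Require Import all_boot all_order all_algebra.
From mathcomp Require Import all_classical all_reals all_analysis.

Set Implicit Arguments.
Unset Strict Implicit.
Unset Printing Implicit Defensive.

Local Open Scope classical_set_scope.

(** Cantor's bijection from [nat * nat] to [nat]. *)
Definition pairn (a b : nat) : nat := Cantor.to_nat (a, b).

(** Partial recursive functionals, as unary functions on [nat] with tuples coded
    by [pairn]:
    - [Rec f g] maps <a, 0> to f a and <a, n+1> to g <a, <n, Rec f g <a, n>>>;
    - [Mu f] maps a to the least n with f <a, n> = 0, provided f <a, i> is
      defined for all i < n;
    - [Oracle] is the characteristic function of the oracle.
    The identity is [Pair Fst Snd]. *)
Inductive code : Type :=
| Zero | Succ | Fst | Snd | Oracle
| Pair of code & code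
| Comp of code & code
| Rec of code & code
| Mu of code.

Fixpoint rec_graph (F G : nat -> nat -> Prop) (a n : nat) : nat -> Prop :=
  if n is n'.+1
  then fun r => exists2 s, rec_graph F G a n' s & G (pairn a (pairn n' s)) r
  else F a.

(** [eval o c n m]: the computation of [c] on input [n] with oracle [o] halts
    with output [m]. *)
Fixpoint eval (o : cantor_space) (c : code) (n m : nat) {struct c} : Prop :=
  match c with
  | Zero => m = 0
  | Succ => m = n.+1
  | Fst => m = (Cantor.of_nat n).1
  | Snd => m = (Cantor.of_nat n).2
  | Oracle => m = nat_of_bool (o n)
  | Pair f g =>
      exists u v, [/\ eval o f n u, eval o g n v & m = pairn u v]
  | Comp f g => exists2 k, eval o g n k & eval o f k m
  | Rec f g =>
      rec_graph (eval o f) (eval o g) (Cantor.of_nat n).1 (Cantor.of_nat n).2 m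
  | Mu f =>
      eval o f (pairn n m) 0 /\
      forall i, i < m -> exists k, eval o f (pairn n i) k.+1
  end.

Fixpoint encode (c : code) : nat :=
  match c with
  | Zero => pairn 0 0
  | Succ => pairn 0 1
  | Fst => pairn 0 2
  | Snd => pairn 0 3
  | Oracle => pairn 0 4
  | Pair f g => pairn 1 (pairn (encode f) (encode g))
  | Comp f g => pairn 2 (pairn (encode f) (encode g))
  | Rec f g => pairn 3 (pairn (encode f) (encode g))
  | Mu f => pairn 4 (encode f)
  end.

Lemma pairn_inj (a b c d : nat) : pairn a b = pairn c d -> a = c /\ b = d.
Proof. by move/Cantor.to_nat_inj => [-> ->]. Qed.

Lemma encode_inj : injective encode.
Proof.
elim=> [|||||f IHf g IHg|f IHf g IHg|f IHf g IHg|f IHf] [|||||f' g'|f' g'|f' g'|f'];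
  move=> /= /pairn_inj [] // _; try by [].
- by move/pairn_inj => [/IHf -> /IHg ->].
- by move/pairn_inj => [/IHf -> /IHg ->].
- by move/pairn_inj => [/IHf -> /IHg ->].
- by move/IHf ->.
Qed.

(** [Phi o e n m]: the Turing functional with index [e], oracle [o] and input
    [n] halts with output [m].  An [e] which codes nothing is an index of the
    nowhere defined functional. *)
Definition Phi (o : cantor_space) (e n m : nat) : Prop :=
  exists2 c, encode c = e & eval o c n m.

Definition empty_oracle : cantor_space := fun=> false.

Definition phi (e n m : nat) : Prop := Phi empty_oracle e n m.

Definition recursive_in (b : cantor_space) (f : nat -> nat) : Prop :=
  exists e, forall n, Phi b e n (f n).

Definition TOT : cantor_space := fun e => `[< forall n, exists m, phi e n m >].

Definition m_reducible (x y : cantor_space) : Prop :=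
  exists (e : nat) (g : nat -> nat),
    (forall n, phi e n (g n)) /\
    (forall n, x n = true <-> y (g n) = true).

Definition one_reducible (x y : cantor_space) : Prop :=
  exists (e : nat) (g : nat -> nat),
    [/\ forall n, phi e n (g n),
        injective g &
        forall n, x n = true <-> y (g n) = true].

Definition m_equiv (x y : cantor_space) : Prop :=
  m_reducible x y /\ m_reducible y x.

Definition one_equiv (x y : cantor_space) : Prop :=
  one_reducible x y /\ one_reducible y x.

Definition join (x y : cantor_space) : cantor_space :=
  fun n => if odd n then y n./2 else x n./2.

Notation cantor_seq := (prod_topology (fun _ : nat => cantor_space)).

Definition join_seq (xs : cantor_seq) : cantor_space :=
  fun n => xs (Cantor.of_nat n).1 (Cantor.of_nat n).2.

(** Lightface: the matrix [M] is a relation on 2^omega x 2^omega x omega x omega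
    recursive in [b], uniformly in its set arguments. *)
Definition Sigma02 (b : cantor_space)
    (E : cantor_space -> cantor_space -> Prop) : Prop :=
  exists M : cantor_space -> cantor_space -> nat -> nat -> bool,
    (exists e, forall x y i j,
       Phi (join b (join x y)) e (pairn i j) (nat_of_bool (M x y i j))) /\
    (forall x y, E x y <-> exists i, forall j, M x y i j = true).

(** A functional producing a number from its set arguments is run on input 0. *)
Definition learnable_by (b : cantor_space)
    (E : cantor_space -> cantor_space -> Prop) : Prop :=
  exists l : nat -> cantor_seq * cantor_space -> nat,
    [/\ forall n, continuous (l n),
        forall (xs : cantor_seq) (x : cantor_space),
          (exists i, E x (xs i)) ->
          exists2 L : nat, l n (xs, x) @[n --> \oo] --> L & E x (xs L) &
        exists2 f : nat -> nat, recursive_in b f &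
          forall (n : nat) (xs : cantor_seq) (x : cantor_space),
            Phi (join b (join (join_seq xs) x)) (f n) 0 (l n (xs, x))].

(* Main.v *)
(** No universal machine is needed for the first half: [phi e n m] holds iff
    the program "run [e] on [n], then search forever unless the result is [m]"
    is total, and an index of that program is primitive recursive in [e], [n]
    and [m]. Hence the graph of [phi e] is decided by one query to [TOT], and
    the matrix of the Sigma02 definition needs no unbounded search.

    Any Sigma02 relation is learnable: the learner keeps a guess <i, k> for an
    index [i] and a witness [k] of [E x (xs i)], together with a counter [j].
    As long as the matrix holds at [k] and [j] it increments [j]; otherwise it
    moves on to the next guess. It settles on the least correct guess. Its
    continuity is the use principle: a halting computation survives small
    perturbations of the oracle. *)

From Stdlib Require Cantor.
From mathcomp Require Import all_boot all_classical all_analysis.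
Require Import Defs.

Set Implicit Arguments.
Unset Strict Implicit.
Unset Printing Implicit Defensive.

Local Open Scope classical_set_scope.
Local Open Scope nat_scope.

(** * Projections of the Cantor pairing *)

Definition pfst (n : nat) : nat := (Cantor.of_nat n).1.
Definition psnd (n : nat) : nat := (Cantor.of_nat n).2.

Lemma pairnK1 (a b : nat) : pfst (pairn a b) = a.
Proof. by rewrite /pfst /pairn Cantor.cancel_of_to. Qed.

Lemma pairnK2 (a b : nat) : psnd (pairn a b) = b.
Proof. by rewrite /psnd /pairn Cantor.cancel_of_to. Qed.

Lemma pairnK (n : nat) : pairn (pfst n) (psnd n) = n.
Proof.
by rewrite /pairn /pfst /psnd -surjective_pairing Cantor.cancel_to_of.
Qed.

Definition pairnE := (pairnK1, pairnK2, pairnK).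

(** * Determinism and the use principle *)

Lemma eval_fun (o : cantor_space) (c : code) (n m m' : nat) :
  eval o c n m -> eval o c n m' -> m = m'.
Proof.
elim: c n m m' => [|||||f IHf g IHg|f IHf g IHg|f IHf g IHg|f IHf] n m m' /=;
  try by move=> -> ->.
- by move=> [u [v [fu gv ->]]] [u' [v' [/(IHf _ _ _ fu) -> /(IHg _ _ _ gv) ->]]].
- by move=> [k gk fk] [k' /(IHg _ _ _ gk) <-]; exact: IHf.
- elim: (Cantor.of_nat n).2 m m' => [|p IHp] m m' /=; first exact: IHf.
  by move=> [s rs gs] [s' /(IHp _ _ rs) <-]; exact: IHg.
(* Of two distinct results, the smaller would be both a zero and a nonzero value of [f]. *)
- move=> [m0 lt_m] [m'0 lt_m']; case: (ltngtP m m') => // lt_mm.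
  + by have [k /(IHf _ _ _ m0)] := lt_m' _ lt_mm.
  + by have [k /(IHf _ _ _ m'0)] := lt_m _ lt_mm.
Qed.

(** A halting computation makes finitely many oracle queries; each answer is eventually constant
    along [F], and a filter is closed under finite intersections. *)
Lemma eval_near (S : Type) (F : set_system S) (FF : Filter F)
    (o : cantor_space) (os : S -> cantor_space) :
  (forall q, \forall s \near F, os s q = o q) ->
  forall c n m, eval o c n m -> \forall s \near F, eval (os s) c n m.
Proof.
move=> oso.
elim=> [|||||f IHf g IHg|f IHf g IHg|f IHf g IHg|f IHf] n m /=;
  try by move=> ->; apply: nearW.
- by move=> ->; apply: filterS (oso n) => s ->.
- move=> [u [v [fu gv ->]]]; have fu' := IHf _ _ fu; have gv' := IHg _ _ gv.
  by apply: filterS2 fu' gv' => s fs gs; exists u, v.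
- move=> [k gk fk]; apply: filterS2 (IHg _ _ gk) (IHf _ _ fk) => s gs fs.
  by exists k.
- elim: (Cantor.of_nat n).2 m => [|p IHp] m /=; first exact: IHf.
  move=> [k rk gk]; apply: filterS2 (IHp _ rk) (IHg _ _ gk) => s rs gs.
  by exists k.
- move=> [m0 lt_m].
  (* Ranging over ['I_m] turns the bounded quantifier into a finite intersection. *)
  have lt_near : \forall s \near F,
      forall i : 'I_m, exists k, eval (os s) f (pairn n i) k.+1.
    apply: filter_forall => i; have [k fk] := lt_m i (ltn_ord i).
    by apply: filterS (IHf _ _ fk) => s fs; exists k.
  apply: filterS2 (IHf _ _ m0) lt_near => s fs lt_s; split=> // i lt_im.
  exact: (lt_s (Ordinal lt_im)).
Qed.

(** * Functions computed uniformly in a family of oracles *)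

(** The code is chosen before [t]: this is the uniformity in set arguments that [Sigma02] and
    [learnable_by] require. *)
Definition unif (T : Type) (o : T -> cantor_space) (f : T -> nat -> nat) : Prop :=
  exists c, forall t n, eval (o t) c n (f t n).

Fixpoint constc (k : nat) : code :=
  if k is k'.+1 then Comp Succ (constc k') else Zero.

Lemma eval_constc (o : cantor_space) (k n : nat) : eval o (constc k) n k.
Proof. by elim: k => //= k IHk; exists k. Qed.

Section Unif.
Variables (T : Type) (o : T -> cantor_space).
Implicit Types (f g h : T -> nat -> nat) (p q : T -> nat -> bool).

Lemma eq_unif f g : (forall t n, f t n = g t n) -> unif o f -> unif o g.
Proof. by move=> fg [c cf]; exists c => t n; rewrite -fg. Qed.

(** The point of [T] supplies one halting run, which shows that [e] codes a program; injectivity of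
    [encode] makes it the same program for all [t]. *)
Lemma unif_Phi (e : nat) f : T ->
  (forall t n, Phi (o t) e n (f t n)) -> unif o f.
Proof.
move=> t0 ef; have [c ce _] := ef t0 0; exists c => t n.
by have [c' ] := ef t n; rewrite -ce => /encode_inj ->.
Qed.

Lemma unif_cst (k : nat) : unif o (fun _ _ => k).
Proof. by exists (constc k) => t n; exact: eval_constc. Qed.

Lemma unif_id : unif o (fun _ n => n).
Proof.
by exists (Pair Fst Snd) => t n /=; exists (pfst n), (psnd n); rewrite pairnK.
Qed.

Lemma unif_comp f g : unif o f -> unif o g -> unif o (fun t n => f t (g t n)).
Proof. by move=> [c cf] [d dg]; exists (Comp c d) => t n /=; exists (g t n). Qed.

Lemma unif_pair f g :
  unif o f -> unif o g -> unif o (fun t n => pairn (f t n) (g t n)).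
Proof.
by move=> [c cf] [d dg]; exists (Pair c d) => t n /=; exists (f t n), (g t n).
Qed.

Lemma unif_fst f : unif o f -> unif o (fun t n => pfst (f t n)).
Proof. by apply: (@unif_comp (fun _ n => pfst n)); exists Fst. Qed.

Lemma unif_snd f : unif o f -> unif o (fun t n => psnd (f t n)).
Proof. by apply: (@unif_comp (fun _ n => psnd n)); exists Snd. Qed.

Lemma unif_succ f : unif o f -> unif o (fun t n => (f t n).+1).
Proof. by apply: (@unif_comp (fun _ n => n.+1)); exists Succ. Qed.

Lemma unif_oracle f : unif o f -> unif o (fun t n => nat_of_bool (o t (f t n))).
Proof. by apply: (@unif_comp (fun t n => nat_of_bool (o t n))); exists Oracle. Qed.

Lemma unif_rec (r : T -> nat -> nat -> nat) f g :
  unif o f -> unif o g ->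
  (forall t a, r t a 0 = f t a) ->
  (forall t a n, r t a n.+1 = g t (pairn a (pairn n (r t a n)))) ->
  unif o (fun t n => r t (pfst n) (psnd n)).
Proof.
move=> [c cf] [d dg] r0 rS; exists (Rec c d) => t n /=.
rewrite -/(pfst n) -/(psnd n); elim: (psnd n) => [|k IHk] /=; first by rewrite r0.
by exists (r t (pfst n) k) => //; rewrite rS.
Qed.

Lemma unif_iter (s : T -> nat -> nat) (s0 : nat) :
  unif o s -> unif o (fun t n => iter n (s t) s0).
Proof.
move=> us; pose r t (_ n : nat) := iter n (s t) s0.
have ur : unif o (fun t n => r t (pfst n) (psnd n)).
  apply: (unif_rec (unif_cst s0) (unif_comp us (unif_snd (unif_snd unif_id)))) => //.
  by move=> t a n; rewrite /r !pairnE.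
apply: eq_unif (unif_comp ur (unif_pair (unif_cst 0) unif_id)) => t n.
by rewrite /r !pairnE.
Qed.

(** Recursion on the truth value: the base case is the else branch, and the step discards the
    recursive value and runs the then branch. *)
Lemma unif_if p f g : unif o (fun t n => nat_of_bool (p t n)) ->
  unif o f -> unif o g -> unif o (fun t n => if p t n then f t n else g t n).
Proof.
move=> up uf ug; pose r t a n := if n is 0 then g t a else f t a.
have ur : unif o (fun t n => r t (pfst n) (psnd n)).
  apply: (unif_rec ug (unif_comp uf (unif_fst unif_id))) => // t a n.
  by rewrite /r pairnE.
apply: eq_unif (unif_comp ur (unif_pair unif_id up)) => t n.
by rewrite /r !pairnE; case: (p t n).
Qed.

Lemma unif_andb p q : unif o (fun t n => nat_of_bool (p t n)) ->
  unif o (fun t n => nat_of_bool (q t n)) ->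
  unif o (fun t n => nat_of_bool (p t n && q t n)).
Proof.
move=> up uq; apply: eq_unif (unif_if up uq (unif_cst 0)) => t n.
by case: (p t n).
Qed.

Lemma unif_implb p q : unif o (fun t n => nat_of_bool (p t n)) ->
  unif o (fun t n => nat_of_bool (q t n)) ->
  unif o (fun t n => nat_of_bool (p t n ==> q t n)).
Proof.
move=> up uq; apply: eq_unif (unif_if up uq (unif_cst 1)) => t n.
by case: (p t n).
Qed.

Lemma unif_eqb p q : unif o (fun t n => nat_of_bool (p t n)) ->
  unif o (fun t n => nat_of_bool (q t n)) ->
  unif o (fun t n => nat_of_bool (p t n == q t n)).
Proof.
move=> up uq.
apply: eq_unif (unif_if up uq (unif_if uq (unif_cst 0) (unif_cst 1))) => t n.
by case: (p t n); case: (q t n).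
Qed.

Lemma unif_pred : unif o (fun _ n => n.-1).
Proof.
pose r (t : T) (_ n : nat) := n.-1.
have ur : unif o (fun t n => r t (pfst n) (psnd n)).
  apply: (unif_rec (unif_cst 0) (unif_fst (unif_snd unif_id))) => //.
  by move=> t a n; rewrite /r !pairnE.
apply: eq_unif (unif_comp ur (unif_pair (unif_cst 0) unif_id)) => t n.
by rewrite /r !pairnE.
Qed.

Lemma unif_sub f g : unif o f -> unif o g -> unif o (fun t n => f t n - g t n).
Proof.
move=> uf ug; pose r (t : T) (a n : nat) := a - n.
have ur : unif o (fun t n => r t (pfst n) (psnd n)).
  apply: (unif_rec unif_id (unif_comp unif_pred (unif_snd (unif_snd unif_id)))).
    by move=> t a; rewrite /r subn0.
  by move=> t a n; rewrite /r !pairnE subnS.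
apply: eq_unif (unif_comp ur (unif_pair uf ug)) => t n.
by rewrite /r !pairnE.
Qed.

Lemma unif_eqn f g :
  unif o f -> unif o g -> unif o (fun t n => nat_of_bool (f t n == g t n)).
Proof.
move=> uf ug; have le0 f' g' : unif o f' -> unif o g' ->
    unif o (fun t n => nat_of_bool (f' t n <= g' t n)).
  move=> uf' ug'.
  (* With truncated subtraction, 1 - (a - b) is 1 exactly when a <= b. *)
  apply: eq_unif (unif_sub (unif_cst 1) (unif_sub uf' ug')) => t n.
  by rewrite /leq; case: (f' t n - g' t n).
apply: eq_unif (unif_andb (le0 _ _ uf ug) (le0 _ _ ug uf)) => t n.
by rewrite eqn_leq.
Qed.

Lemma unif_double f : unif o f -> unif o (fun t n => (f t n).*2).
Proof.
apply: (@unif_comp (fun _ n => n.*2)).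
apply: eq_unif (unif_iter 0 (unif_succ (unif_succ unif_id))) => t n.
by elim: n => //= n ->; rewrite doubleS.
Qed.

Lemma unif_odd f : unif o f -> unif o (fun t n => nat_of_bool (odd (f t n))).
Proof.
apply: (@unif_comp (fun _ n => nat_of_bool (odd n))).
apply: eq_unif (unif_iter 0 (unif_sub (unif_cst 1) unif_id)) => t n.
by elim: n => //= n ->; case: (odd n).
Qed.

Lemma unif_half f : unif o f -> unif o (fun t n => (f t n)./2).
Proof.
apply: (@unif_comp (fun _ n => n./2)).
pose r (t : T) (_ n : nat) := n./2.
have ur : unif o (fun t n => r t (pfst n) (psnd n)).
  (* Passing from n to n+1 raises the half exactly when n is odd. *)
  apply: (unif_rec (unif_cst 0) (unif_if (unif_odd (unif_fst (unif_snd unif_id)))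
    (unif_succ (unif_snd (unif_snd unif_id))) (unif_snd (unif_snd unif_id)))) => //.
  move=> t a n; rewrite /r !pairnE -[n.+1./2]/(uphalf n) uphalf_half.
  by case: (odd n).
apply: eq_unif (unif_comp ur (unif_pair (unif_cst 0) unif_id)) => t n.
by rewrite /r !pairnE.
Qed.

(** Needed to compute indices of programs with hard-wired inputs, as in the s-m-n theorem. *)
Lemma unif_encode_constc f :
  unif o f -> unif o (fun t n => encode (constc (f t n))).
Proof.
apply: (@unif_comp (fun _ n => encode (constc n))).
apply: eq_unif (unif_iter (encode Zero) (unif_pair (unif_cst 2)
  (unif_pair (unif_cst (encode Succ)) unif_id))) => t n.
by elim: n => [//|n IHn]; rewrite iterS IHn.
Qed.

End Unif.

(** * Queries to the components of a joined oracle *)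

Lemma joinE0 (x y : cantor_space) (n : nat) : join x y n.*2 = x n.
Proof. by rewrite /join odd_double doubleK. Qed.

Lemma joinE1 (x y : cantor_space) (n : nat) : join x y n.*2.+1 = y n.
Proof. by rewrite /join /= odd_double /= uphalf_double. Qed.

Section UnifJoin.
Variables (T : Type) (b : cantor_space) (x y : T -> cantor_space).
Let o (t : T) : cantor_space := join b (join (x t) (y t)).
Variable f : T -> nat -> nat.
Hypothesis uf : unif o f.

(** Bit n of [b], [x t] and [y t] sits at address 2n, 4n+1 and 4n+3 of [o t] respectively. *)
Lemma unif_join0 : unif o (fun t n => nat_of_bool (b (f t n))).
Proof.
by apply: eq_unif (unif_oracle (unif_double uf)) => t n; rewrite /o joinE0.
Qed.

Lemma unif_join1 : unif o (fun t n => nat_of_bool (x t (f t n))).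
Proof.
apply: eq_unif (unif_oracle (unif_succ (unif_double (unif_double uf)))) => t n.
by rewrite /o joinE1 joinE0.
Qed.

Lemma unif_join2 : unif o (fun t n => nat_of_bool (y t (f t n))).
Proof.
apply: eq_unif
  (unif_oracle (unif_succ (unif_double (unif_succ (unif_double uf))))) => t n.
by rewrite /o !joinE1.
Qed.

End UnifJoin.

(** * Changing the oracle *)

Section Relativize.
Variables (T : Type) (o : T -> cantor_space) (o' : T -> nat -> cantor_space).
Hypothesis uo' : unif o (fun t n => nat_of_bool (o' t (pfst n) (psnd n))).

(* The simulated oracle [o' t i] depends on the parameter [i], which the
   translated program carries along as the first component of its input. *)
Lemma relativize (c : code) : exists d, forall t i n m,
  eval (o' t i) c n m -> eval (o t) d (pairn i n) m.
Proof.
elim: c => [|||||f [f' IHf] g [g' IHg]|f [f' IHf] g [g' IHg]|f [f' IHf] g [g' IHg]|f [f' IHf]].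
- by exists Zero.
- by exists (Comp Succ Snd) => t i n m -> /=; exists n; rewrite -/(psnd _) ?pairnE.
- by exists (Comp Fst Snd) => t i n m -> /=; exists n; rewrite -/(psnd _) ?pairnE.
- by exists (Comp Snd Snd) => t i n m -> /=; exists n; rewrite -/(psnd _) ?pairnE.
- have [d dP] := uo'; exists d => t i n m -> /=.
  by have := dP t (pairn i n); rewrite !pairnE.
- exists (Pair f' g') => t i n m /= [u [v [fu gv ->]]].
  by exists u, v; split=> //; [exact: IHf|exact: IHg].
- exists (Comp f' (Pair Fst g')) => t i n m /= [k gk fk].
  exists (pairn i k); last exact: IHf.
  by exists i, k; split=> //; [rewrite -/(pfst _) pairnE|exact: IHg].
(* [d] sends <i, <a, n>> to <<i, a>, n>, so that [i] travels in the recursion parameter; [s] sends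
   <<i, a>, z> back to <i, <a, z>> for the translated step. *)
- have [d dP] := unif_pair (unif_pair (unif_fst (unif_id o))
    (unif_fst (unif_snd (unif_id o)))) (unif_snd (unif_snd (unif_id o))).
  have [s sP] := unif_pair (unif_fst (unif_fst (unif_id o)))
    (unif_pair (unif_snd (unif_fst (unif_id o))) (unif_snd (unif_id o))).
  exists (Comp (Rec f' (Comp g' s)) d) => t i n m /=.
  rewrite -/(pfst n) -/(psnd n) => rm; eexists; first exact: dP.
  rewrite -/(pfst _) -/(psnd _) !pairnE.
  elim: (psnd n) m rm => [|k IHk] m /=; first exact: IHf.
  move=> [r rr gr]; exists r; first exact: IHk.
  by eexists; [exact: sP|rewrite !pairnE; exact: IHg].
- have [s sP] := unif_pair (unif_fst (unif_fst (unif_id o)))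
    (unif_pair (unif_snd (unif_fst (unif_id o))) (unif_snd (unif_id o))).
  exists (Mu (Comp f' s)) => t i n m /= [m0 lt_m]; split.
    by eexists; [exact: sP|rewrite !pairnE; exact: IHf].
  move=> j /lt_m [k fk]; exists k.
  by eexists; [exact: sP|rewrite !pairnE; exact: IHf].
Qed.

(** Lets a learner that holds a whole sequence run a program meant for the oracle built from a
    single member [i] of it. *)
Lemma unif_relativize (S : Type) (a : T -> nat -> S)
    (oS : S -> cantor_space) (f : S -> nat -> nat) :
  (forall t i, oS (a t i) = o' t i) -> unif oS f ->
  unif o (fun t n => f (a t (pfst n)) (psnd n)).
Proof.
move=> oSE [c cP]; have [d dP] := relativize c; exists d => t n.
by rewrite -{1}(pairnK n); apply: dP; rewrite -oSE.
Qed.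

End Relativize.

(** * Learning Sigma02 relations *)

Definition learner_oracle (b : cantor_space) (t : cantor_seq * cantor_space) :
  cantor_space := join b (join (join_seq t.1) t.2).

(** Each bit of the oracle is fixed or copies one coordinate of the input, and coordinate
    projections into the discrete space [bool] are continuous. *)
Lemma learner_oracle_near (b : cantor_space) (t : cantor_seq * cantor_space)
    (q : nat) :
  \forall s \near t, learner_oracle b s q = learner_oracle b t q.
Proof.
case: t => xs x.
have x_near n : \forall s \near (xs, x), s.2 n = x n.
  have : \forall y \near x, y n = x n.
    exact: (@proj_continuous nat (fun=> bool) n x _ (discrete_set1 (x n))).
  exact: cvg_snd.
have xs_near i n : \forall s \near (xs, x), s.1 i n = xs i n.
  have yP : \forall y \near xs i, y n = xs i n.
    exact: (@proj_continuous nat (fun=> bool) n (xs i) _ (discrete_set1 (xs i n))).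
  have : \forall y \near xs, y i n = xs i n.
    exact: (@proj_continuous nat (fun=> cantor_space) i xs _ yP).
  exact: cvg_fst.
rewrite /learner_oracle /join /join_seq /=; case: (odd q); last exact: filterE.
by case: (odd q./2); [exact: x_near|exact: xs_near].
Qed.

(** A state codes the current guess together with the number of tests it has passed. *)
Definition guess_step (P : nat -> nat -> bool) (s : nat) : nat :=
  if P (pfst s) (psnd s) then pairn (pfst s) (psnd s).+1
  else pairn (pfst s).+1 0.

Definition guess (P : nat -> nat -> bool) (n : nat) : nat :=
  iter n (guess_step P) (pairn 0 0).

(** Every guess below the least correct one fails some test and is abandoned; the least correct
    guess is then reached and kept forever. *)
Lemma guess_cvg (P : nat -> nat -> bool) : (exists p, forall j, P p j) ->
  exists2 p, forall j, P p j & exists N, forall n, N <= n -> pfst (guess P n) = p.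
Proof.
move=> [p0 p0P]; pose good p := `[< forall j, P p j >].
have [|p /asboolP pP p_min] := @ex_minnP good; first by exists p0; exact/asboolP.
exists p => //.
have run n a j k : guess P n = pairn a j -> (forall i, i < k -> P a (j + i)) ->
    guess P (n + k) = pairn a (j + k).
  move=> na; elim: k => [|k IHk] Pk; first by rewrite !addn0.
  rewrite addnS /guess iterS -/(guess P (n + k)) IHk => [|i ik].
    by rewrite /guess_step !pairnE Pk // addnS.
  by apply: Pk; exact: ltnW.
have reach a : a <= p -> exists n, guess P n = pairn a 0.
  elim: a => [|a IHa] ap; first by exists 0.
  have [n na] := IHa (ltnW ap).
  have ex_fail : exists j, ~~ P a j.
    have /asboolPn : ~~ good a by apply/negP => /p_min; rewrite leqNgt ap.
    by move=> /existsNP [j /negP]; exists j.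
  have [j Pj j_min] := ex_minnP ex_fail.
  exists (n + j).+1; rewrite /guess iterS -/(guess P (n + j)) (run _ a 0) //.
    by rewrite /guess_step !pairnE add0n (negbTE Pj).
  by move=> i ij; apply: contraLR ij => /j_min; rewrite -leqNgt add0n.
have [N Np] := reach p (leqnn p); exists N => n Nn.
by rewrite -(subnKC Nn) (run N p 0) ?pairnE // => i _; exact: pP.
Qed.

Lemma Sigma02_learnable (b : cantor_space)
    (E : cantor_space -> cantor_space -> Prop) :
  Sigma02 b E -> learnable_by b E.
Proof.
move=> [M [[eM MP] EM]].
pose S := (cantor_space * cantor_space)%type.
pose oS (s : S) : cantor_space := join b (join s.1 s.2).
pose T := (cantor_seq * cantor_space)%type.
pose o : T -> cantor_space := learner_oracle b.
have uM : unif oS (fun s n => nat_of_bool (M s.1 s.2 (pfst n) (psnd n))).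
  apply: (@unif_Phi _ _ eM); first by split=> ?; exact: false.
  by move=> [x y] n; rewrite -{1}(pairnK n); exact: MP.
have uo' : unif o (fun t n =>
    nat_of_bool (join b (join t.2 (t.1 (pfst n))) (psnd n))).
  have q := unif_snd (unif_id o); have hq := unif_half q; have hhq := unif_half hq.
  have xsq := unif_join1 (unif_pair (unif_fst (unif_id o)) hhq).
  (* The parities of the query and of its half select the component; the learner's oracle stores the
     sequence before [x], in the opposite order to the simulated one. *)
  apply: eq_unif (unif_if (unif_odd q) (unif_if (unif_odd hq) xsq
    (unif_join2 hhq)) (unif_join0 hq)) => t n.
  rewrite /join; case: ifP => // _; case: ifP => // _.
  by rewrite /join_seq -/(pfst _) -/(psnd _) !pairnE.
pose P (t : T) p j := M t.2 (t.1 (pfst p)) (psnd p) j.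
have uP : unif o (fun t s => nat_of_bool (P t (pfst s) (psnd s))).
  have uMi := @unif_relativize T o _ uo' S (fun t i => (t.2, t.1 i)) oS _
    (fun _ _ => erefl) uM.
  have us := unif_id o; have us1 := unif_fst us.
  apply: eq_unif (unif_comp uMi (unif_pair (unif_fst us1)
    (unif_pair (unif_snd us1) (unif_snd us)))) => t n.
  by rewrite /P !pairnE.
(* The outer projections take the state to its guess <i, k>, and the guess to i. *)
pose l n (t : T) := pfst (pfst (guess (P t) n)).
have [W WP] : unif o (fun t n => l n t).
  apply: unif_fst; apply: unif_fst; apply: unif_iter; apply: unif_if uP _ _.
    exact: unif_pair (unif_fst (unif_id _)) (unif_succ (unif_snd (unif_id _))).
  exact: unif_pair (unif_succ (unif_fst (unif_id _))) (unif_cst _ 0).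
exists l; split.
(* [l n] is locally constant: the run of [W] at [t] halts with the same value for nearby inputs, and
   results are unique. *)
- move=> n t; apply: cvg_near_cst.
  apply: filterS (eval_near _ (learner_oracle_near b t) (WP t n)) => s.
  exact: eval_fun (WP s n).
- move=> xs x [i /EM [k kP]].
  have [|p pP [N NP]] := @guess_cvg (P (xs, x)).
    by exists (pairn i k) => j; rewrite /P !pairnE /=; exact: kP.
  exists (pfst p); last by apply/EM; exists (psnd p) => j; exact: pP.
  apply: cvg_near_cst; exists N => // n /= Nn.
  by rewrite /l NP.
(* Stage [n] is [W] with [n] hard-wired; it ignores its input 0. *)
- exists (fun n => encode (Comp W (constc n))).
    pose ob (_ : unit) := b.
    have [c cP] := unif_pair (unif_cst ob 2)
      (unif_pair (unif_cst ob (encode W)) (unif_encode_constc (unif_id ob))).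
    by exists (encode c) => n; exists c => //; exact: (cP tt).
  move=> n xs x; exists (Comp W (constc n)) => //=; exists n; last exact: WP (xs, x) n.
  exact: eval_constc.
Qed.

(** * The graph of a computable function as a query to TOT *)

Lemma TOT_encode (c : code) :
  TOT (encode c) <-> forall n, exists m, eval empty_oracle c n m.
Proof.
split=> [/asboolP H n|H].
  by have [m [d /encode_inj -> dm]] := H n; exists m.
by apply/asboolP => n; have [m cm] := H n; exists m, c.
Qed.

(** For [e = encode c] and [K = encode s] this is the code of [Comp s (Pair (Comp c (constc n))
    (constc m))], written arithmetically so that it is visibly computable in [e], [n] and [m]. *)
Definition graph_index (K e n m : nat) : nat :=
  pairn 2 (pairn K
    (pairn 1 (pairn (pairn 2 (pairn e (encode (constc n)))) (encode (constc m))))).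

Lemma graph_index_exists : exists K, forall c n m,
  TOT (graph_index K (encode c) n m) <-> eval empty_oracle c n m.
Proof.
pose o (_ : unit) := empty_oracle.
(* On <<u, v>, i> the test ignores the search variable i: [Mu d] returns 0 on <u, v> if u = v and
   diverges otherwise. *)
have [d dP] : unif o (fun _ a =>
    if pfst (pfst a) == psnd (pfst a) then 0 else 1).
  by apply: unif_if (unif_eqn _ _) (unif_cst _ 0) (unif_cst _ 1);
    [apply: unif_fst|apply: unif_snd]; exact: unif_fst (unif_id _).
exists (encode (Mu d)) => c n m.
rewrite -[graph_index _ _ _ _]/(encode
  (Comp (Mu d) (Pair (Comp c (constc n)) (constc m)))).
(* The program ignores its input, so halting on 0 already carries all the information. *)
rewrite TOT_encode; split=> [/(_ 0) | cm k].
  move=> [r /= [p [u [v [[n' /eval_fun n'n cu] /eval_fun vm ->]]]]] [d0 _].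
  have := eval_fun d0 (dP tt _); rewrite !pairnE.
  rewrite -(vm _ (eval_constc _ _ _)).
  by case: eqP => // <- _; rewrite -(n'n _ (eval_constc _ _ _)) in cu *.
exists 0 => /=; exists (pairn m m).
  exists m, m; split=> //; last exact: eval_constc.
  by exists n => //; exact: eval_constc.
by split=> //; have := dP tt (pairn (pairn m m) 0); rewrite !pairnE eqxx.
Qed.

(** * Complexity of the reducibilities *)

Section Reducibility.
Variable K : nat.
Hypothesis graph_indexP : forall c n m,
  TOT (graph_index K (encode c) n m) <-> eval empty_oracle c n m.

(** [j] codes a pair <n, m>, tested only if it lies on the graph of [phi e]. The conjunct [TOT e]
    also guarantees that [e] codes a program, as the meaning of [graph_index] requires. *)
Definition m_matrix (x y : cantor_space) (e j : nat) : bool :=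
  TOT e &&
  (TOT (graph_index K e (pfst j) (psnd j)) ==> (x (pfst j) == y (psnd j))).

(** [j] codes <n, <v, n'>>, where v is a candidate common value at n and n'. *)
Definition inj_matrix (e j : nat) : bool :=
  (TOT (graph_index K e (pfst j) (pfst (psnd j))) &&
   TOT (graph_index K e (psnd (psnd j)) (pfst (psnd j)))) ==>
  (pfst j == psnd (psnd j)).

Definition one_matrix (x y : cantor_space) (e j : nat) : bool :=
  m_matrix x y e j && inj_matrix e j.

Lemma phi_graph_index (e n m : nat) : TOT e ->
  TOT (graph_index K e n m) <-> phi e n m.
Proof.
move=> /asboolP/(_ 0)[_ [c <- _]]; rewrite graph_indexP.
by split=> [cm|[d /encode_inj -> //]]; exists c.
Qed.

Lemma TOTP (e : nat) : TOT e <-> exists g, forall n, phi e n (g n).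
Proof.
split=> [/asboolP/choice[g gP]|[g gP]]; first by exists g.
by apply/asboolP => n; exists (g n).
Qed.

Lemma phi_fun (e n m m' : nat) : phi e n m -> phi e n m' -> m = m'.
Proof. by move=> [c <- cm] [d /encode_inj -> /(eval_fun cm)]. Qed.

Lemma m_matrixP (x y : cantor_space) (e : nat) (g : nat -> nat) :
  (forall n, phi e n (g n)) ->
  (forall j, m_matrix x y e j) <-> (forall n, x n = true <-> y (g n) = true).
Proof.
move=> gP; have Te : TOT e by apply/TOTP; exists g.
split=> [H n|H j]; last first.
  rewrite /m_matrix Te /=; apply/implyP => /(phi_graph_index _ _ Te)/(phi_fun (gP _)) <-.
  by apply/eqP; apply/idP/idP => /H.
have := H (pairn n (g n)); rewrite /m_matrix Te /= !pairnE => /implyP/(_ _)/eqP.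
by move=> ->; [|exact/phi_graph_index].
Qed.

Lemma inj_matrixP (e : nat) (g : nat -> nat) :
  (forall n, phi e n (g n)) -> (forall j, inj_matrix e j) <-> injective g.
Proof.
move=> gP; have Te : TOT e by apply/TOTP; exists g.
split=> [H n n' gnn'|H j].
  have := H (pairn n (pairn (g n) n')); rewrite /inj_matrix !pairnE.
  move=> /implyP/(_ _)/eqP; apply; apply/andP; split.
    exact/phi_graph_index.
  by rewrite gnn'; exact/phi_graph_index.
apply/implyP => /andP[/(phi_graph_index _ _ Te)/(phi_fun (gP _)) gj].
move=> /(phi_graph_index _ _ Te)/(phi_fun (gP _)) gj'.
by apply/eqP/H; rewrite gj gj'.
Qed.

Lemma m_reducibleE (x y : cantor_space) :
  m_reducible x y <-> exists e, forall j, m_matrix x y e j.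
Proof.
split=> [[e [g [gP xy]]]|[e eP]]; first by exists e; exact/(m_matrixP _ _ gP).
(* Any instance of the matrix contains [TOT e], which yields the reducing function. *)
have /andP[/TOTP[g gP] _] := eP 0.
by exists e, g; split=> //; exact/(m_matrixP _ _ gP).
Qed.

Lemma one_reducibleE (x y : cantor_space) :
  one_reducible x y <-> exists e, forall j, one_matrix x y e j.
Proof.
split=> [[e [g [gP g_inj xy]]]|[e eP]].
  exists e => j; rewrite /one_matrix (proj2 (m_matrixP x y gP) xy).
  exact: (proj2 (inj_matrixP gP) g_inj).
have /andP[/andP[/TOTP[g gP] _] _] := eP 0.
exists e, g; split=> //.
  by apply/(inj_matrixP gP) => j; have /andP[] := eP j.
by apply/(m_matrixP _ _ gP) => j; have /andP[] := eP j.
Qed.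

(** * Computability of the matrices *)

Section Matrix.
Variables (T : Type) (o : T -> cantor_space) (x y : T -> cantor_space).
(** Access to the three sets is kept abstract so that [x] and [y] can be exchanged for the reverse
    reduction. *)
Hypothesis uTOT : forall f, unif o f -> unif o (fun t n => nat_of_bool (TOT (f t n))).
Hypothesis ux : forall f, unif o f -> unif o (fun t n => nat_of_bool (x t (f t n))).
Hypothesis uy : forall f, unif o f -> unif o (fun t n => nat_of_bool (y t (f t n))).

Lemma unif_TOT_graph_index e f g : unif o e -> unif o f -> unif o g ->
  unif o (fun t n => nat_of_bool (TOT (graph_index K (e t n) (f t n) (g t n)))).
Proof.
move=> ue uf ug; apply: uTOT; apply: unif_pair (unif_cst _ _) _.
apply: unif_pair (unif_cst _ _) _; apply: unif_pair (unif_cst _ _) _.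
apply: unif_pair (unif_pair (unif_cst _ _) _) (unif_encode_constc ug).
exact: unif_pair ue (unif_encode_constc uf).
Qed.

Lemma unif_m_matrix e f : unif o e -> unif o f ->
  unif o (fun t n => nat_of_bool (m_matrix (x t) (y t) (e t n) (f t n))).
Proof.
move=> ue uf; have uf1 := unif_fst uf; have uf2 := unif_snd uf.
apply: unif_andb (uTOT ue) _; apply: unif_implb; first exact: unif_TOT_graph_index.
exact: unif_eqb (ux uf1) (uy uf2).
Qed.

Lemma unif_one_matrix e f : unif o e -> unif o f ->
  unif o (fun t n => nat_of_bool (one_matrix (x t) (y t) (e t n) (f t n))).
Proof.
move=> ue uf; have uf1 := unif_fst uf.
have uf21 := unif_fst (unif_snd uf); have uf22 := unif_snd (unif_snd uf).
apply: unif_andb; first exact: unif_m_matrix.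
by apply: unif_implb (unif_andb _ _) (unif_eqn uf1 uf22); exact: unif_TOT_graph_index.
Qed.

End Matrix.

(** The witnesses of the two reductions are merged into one pair, and both matrices share the
    universal variable [j]. *)
Lemma Sigma02_sym (b : cantor_space) (R E : cantor_space -> cantor_space -> Prop)
    (A : cantor_space -> cantor_space -> nat -> nat -> bool) :
  let o (t : cantor_space * cantor_space) := join b (join t.1 t.2) in
  (forall e f, unif o e -> unif o f ->
    unif o (fun t n => nat_of_bool (A t.1 t.2 (e t n) (f t n)))) ->
  (forall e f, unif o e -> unif o f ->
    unif o (fun t n => nat_of_bool (A t.2 t.1 (e t n) (f t n)))) ->
  (forall x y, R x y <-> exists e, forall j, A x y e j) ->
  (forall x y, E x y <-> R x y /\ R y x) ->
  Sigma02 b E.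
Proof.
move=> o uA uA' RA ER.
exists (fun x y i j => A x y (pfst i) j && A y x (psnd i) j); split.
  have ui := unif_fst (unif_id o); have uj := unif_snd (unif_id o).
  have [c cP] := unif_andb (uA _ _ (unif_fst ui) uj) (uA' _ _ (unif_snd ui) uj).
  exists (encode c) => x y i j; exists c => //.
  by have := cP (x, y) (pairn i j); rewrite !pairnE.
move=> x y; rewrite ER !RA; split=> [[[e eP] [e' e'P]]|[i iP]].
  by exists (pairn e e') => j; rewrite !pairnE eP e'P.
by split; [exists (pfst i)|exists (psnd i)] => j; have /andP[] := iP j.
Qed.

Lemma Sigma02_m_equiv : Sigma02 TOT m_equiv.
Proof.
apply: (Sigma02_sym _ _ m_reducibleE) => [e f|e f|//]; apply: unif_m_matrix => h.
all: by [exact: unif_join0|exact: unif_join1|exact: unif_join2].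
Qed.

Lemma Sigma02_one_equiv : Sigma02 TOT one_equiv.
Proof.
apply: (Sigma02_sym _ _ one_reducibleE) => [e f|e f|//]; apply: unif_one_matrix => h.
all: by [exact: unif_join0|exact: unif_join1|exact: unif_join2].
Qed.

End Reducibility.

Theorem theorem4p5 :
  (Sigma02 TOT m_equiv /\ Sigma02 TOT one_equiv) /\
  (learnable_by TOT m_equiv /\ learnable_by TOT one_equiv).
Proof.
have [K KP] := graph_index_exists.
have Sm := Sigma02_m_equiv KP; have S1 := Sigma02_one_equiv KP.
by split; split=> //; exact: Sigma02_learnable.
Qed.
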